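(* Let $(X,e)$ be a pointed metric space with metric $d$. Then the topology induced by the metric $d_{\mathbb{Z}[X]}$ makes $\mathbb{Z}[X]$, with its usual addition of formal sums, an abelian topological group.
   Context: Let $(X,d)$ be a metric space with distinguished basepoint $e\in X$. For $n\ge 1$, $\mathrm{SP}^n(X)=X^n/S_n$ is the quotient of $X^n$ by the coordinate-permutation action of the symmetric group $S_n$; the orbit of $(x_1,\dots,x_n)$ is written $[x_1,\dots,x_n]$. The map $[x_1,\dots,x_n]\mapsto[x_1,\dots,x_n,e]$ embeds $\mathrm{SP}^n(X)$ in $\mathrm{SP}^{n+1}(X)$, and the set $\mathrm{SP}(X)$ is the union $\bigcup_{n\ge1}\mathrm{SP}^n(X)$ of the increasing sequence so obtained. Thus elements of $\mathrm{SP}(X)$ are finite unordered lists $[x_1,\dots,x_m]$ of points of $X$, with $[x_1,\dots,x_m]=[x_1,\dots,x_m,e]$. Under concatenation $[x_1,\dots,x_m]+[y_1,\dots,y_n]=[x_1,\dots,x_m,y_1,\dots,y_n]$, $\mathrm{SP}(X)$ is a commutative monoid with identity $[e]$; its elements are also written as finite formal sums $\sum a_i x_i$ with nonnegative integer coefficients recording multiplicities. Matching distance: for $[x_1,\dots,x_m],[y_1,\dots,y_n]\in \mathrm{SP}(X)$ and $N\ge m+n$ let $\mathbf{x}_N=(x_1,\dots,x_m,e,\dots,e)$ and $\mathbf{y}_N=(y_1,\dots,y_n,e,\dots,e)$ be the lists padded with copies of $e$ to length $N$, and let $\mathbf{x}_N(i)$, $\mathbf{y}_N(i)$ be their $i$-th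 entries. Then $$d_{\mathbb{N}[X]}([x_1,\dots,x_m],[y_1,\dots,y_n]):=\inf_{N\ge m+n}\ \min_{\sigma\in S_N}\ \sum_{i=1}^N d\bigl(\mathbf{x}_N(i),\mathbf{y}_N(\sigma(i))\bigr),$$ which is a well-defined metric on the set $\mathrm{SP}(X)$. The metric space $(\mathrm{SP}(X),d_{\mathbb{N}[X]})$ is denoted $\mathbb{N}[X]$. $\mathbb{Z}[X]$ is the free abelian group of finite formal sums $\sum b_j y_j$ with $b_j\in\mathbb{Z}$, $y_j\in X$, in which the basepoint $e$ is identified with the zero element (so it is the group completion of $\mathbb{N}[X]$). Every $x\in\mathbb{Z}[X]$ can be written $x=x^+-x^-$ with $x^+,x^-$ finite formal sums with nonnegative coefficients, i.e. $x^{\pm}\in \mathrm{SP}(X)$. The matching distance on $\mathbb{Z}[X]$ is $d_{\mathbb{Z}[X]}(x,y):=d_{\mathbb{N}[X]}(x^{+}+y^{-},\,y^{+}+x^{-})$, which does not depend on the chosen decompositions and is a metric. *)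

(* Defs.v *)
From HB Require Import structures.
From mathcomp Require Import all_boot all_order all_algebra all_fingroup.
From mathcomp Require Import generic_quotient ring_quotient.
From mathcomp Require Import all_classical all_reals all_analysis.
From mathcomp.multinomials Require Import freeg.
From mathcomp Require Import zify.

Set Implicit Arguments.
Unset Strict Implicit.
Unset Printing Implicit Defensive.

Import Order.TTheory GRing.Theory Num.Theory.

Local Open Scope classical_set_scope.
Local Open Scope quotient_scope.
Local Open Scope ring_scope.

Section infinite_symmetric_product.
Context {R : realType} {X : metricType R} (e : X).
Implicit Types s t u : seq X.

(* Two lists are identified iff they agree up to reordering after padding with
   copies of e; as [::] is identified with [:: e], allowing the empty list adds
   nothing to the union of the SP^n(X), n >= 1. *)
Definition sp_equiv s t : bool :=
  `[< exists a b, perm_eq (s ++ nseq a e) (t ++ nseq b e) >].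

Local Notation red := (seq.filter (predC1 e)).

Lemma sp_equivE s t : sp_equiv s t = perm_eq (red s) (red t).
Proof.
have redn n : red (nseq n e) = [::] by elim: n => //= n ->; rewrite eqxx.
have permred v : perm_eq v (red v ++ nseq (count_mem e v) e).
  elim: v => //= x v IH; case: eqVneq => [->|xe] /=.
    by rewrite perm_sym (perm_catCA _ [:: e]) /= perm_cons perm_sym.
  by rewrite perm_cons.
apply/asboolP/idP => [[a [b /(perm_filter (predC1 e))]]|st].
  by rewrite !filter_cat !redn !cats0.
exists (count_mem e t), (count_mem e s).
rewrite (perm_trans (y := (red s ++ nseq (count_mem e s) e)
  ++ nseq (count_mem e t) e)) ?perm_cat2r ?permred//.
rewrite perm_sym (perm_trans (y := (red t ++ nseq (count_mem e t) e)
  ++ nseq (count_mem e s) e)) ?perm_cat2r ?permred//.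
by rewrite -!catA (perm_cat (s1 := red t)) ?(perm_sym (red t))// perm_catC.
Qed.

Lemma sp_equiv_refl : reflexive sp_equiv.
Proof. by move=> s; rewrite sp_equivE. Qed.

Lemma sp_equiv_sym : symmetric sp_equiv.
Proof. by move=> s t; rewrite !sp_equivE perm_sym. Qed.

Lemma sp_equiv_trans : transitive sp_equiv.
Proof. by move=> s t u; rewrite !sp_equivE; exact: perm_trans. Qed.

Canonical sp_equiv_rel :=
  EquivRel sp_equiv sp_equiv_refl sp_equiv_sym sp_equiv_trans.

Definition SP := {eq_quot sp_equiv}.

HB.instance Definition _ := Choice.on SP.
HB.instance Definition _ := EqQuotient.on SP.

Definition sp_class s : SP := \pi_SP s.

Lemma sp_classP s t : reflect (sp_class s = sp_class t) (sp_equiv s t).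
Proof. exact: eqmodP. Qed.

Lemma sp_reprK (a : SP) : sp_class (repr a) = a.
Proof. exact: reprK. Qed.

Lemma sp_repr_class s : sp_equiv (repr (sp_class s)) s.
Proof. by apply/sp_classP; rewrite sp_reprK. Qed.

Lemma sp_equiv_cat s s' t t' :
  sp_equiv s s' -> sp_equiv t t' -> sp_equiv (s ++ t) (s' ++ t').
Proof. by rewrite !sp_equivE !filter_cat; exact: perm_cat. Qed.

Lemma perm_sp_equiv s t : perm_eq s t -> sp_equiv s t.
Proof. by rewrite sp_equivE; exact: perm_filter. Qed.

Lemma sp_equiv_cons x s t : sp_equiv (x :: s) (x :: t) = sp_equiv s t.
Proof. by rewrite !sp_equivE /=; case: ifP => // _; rewrite perm_cons. Qed.

Lemma sp_equiv_e s : sp_equiv (e :: s) s.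
Proof. by rewrite sp_equivE /= eqxx. Qed.

Lemma sp_equiv_nseq n s : sp_equiv (s ++ nseq n e) s.
Proof.
rewrite sp_equivE filter_cat.
have -> : red (nseq n e) = [::] by elim: n => //= n ->; rewrite eqxx.
by rewrite cats0.
Qed.

Definition sp_add (a b : SP) : SP := sp_class (repr a ++ repr b).

Lemma sp_classD s t : sp_class (s ++ t) = sp_add (sp_class s) (sp_class t).
Proof.
by apply/sp_classP/sp_equiv_cat; rewrite sp_equiv_sym sp_repr_class.
Qed.

Lemma sp_addA : associative sp_add.
Proof.
move=> a b c; rewrite -[a]sp_reprK -[b]sp_reprK -[c]sp_reprK.
by rewrite -!sp_classD catA.
Qed.

Lemma sp_addC : commutative sp_add.
Proof.
by move=> a b; apply/sp_classP/perm_sp_equiv; rewrite perm_catC.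
Qed.

Lemma sp_add0 : left_id (sp_class [:: e]) sp_add.
Proof.
move=> a; rewrite -[a]sp_reprK -sp_classD; apply/sp_classP.
exact: sp_equiv_e.
Qed.

HB.instance Definition _ := GRing.isNmodule.Build SP sp_addA sp_addC sp_add0.

Lemma sp_class_cat s t : sp_class (s ++ t) = sp_class s + sp_class t.
Proof. exact: sp_classD. Qed.

(* The default value e of nth pads s and t with copies of e. *)
Definition match_cost s t N (sigma : 'S_N) : R :=
  \sum_(i < N) mdist (nth e s i) (nth e t (sigma i)).

Definition min_match_cost s t N : R :=
  \big[Num.min/match_cost s t (1%g : 'S_N)]_(sigma : 'S_N) match_cost s t sigma.

Definition match_dist s t : R :=
  inf [set min_match_cost s t N | N in [set N | (size s + size t <= N)%N]].

Definition sp_dist (a b : SP) : R := match_dist (repr a) (repr b).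

(* For the proofs, a matching is a list of pairs, up to padding by (e, e). *)
Local Notation matching p s t :=
  (sp_equiv (unzip1 p) s /\ sp_equiv (unzip2 p) t).
Local Notation cost p := (\sum_(xy <- p) mdist xy.1 xy.2).

Let cost_ge0 (p : seq (X * X)) : 0 <= cost p.
Proof. by apply: sumr_ge0 => i _; exact: mdist_ge0. Qed.

Let match_cost_ge0 s t N (sigma : 'S_N) : 0 <= match_cost s t sigma.
Proof. by apply: sumr_ge0 => i _; exact: mdist_ge0. Qed.

Let min_match_costP s t N :
  (exists sigma : 'S_N, min_match_cost s t N = match_cost s t sigma) /\
  (forall sigma : 'S_N, min_match_cost s t N <= match_cost s t sigma).
Proof.
split; last by move=> sigma; exact: bigmin_le.
rewrite /min_match_cost; elim/big_ind: _ => [|x y [a ->] [b ->]|a _].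
- by exists 1%g.
- by rewrite /Num.min; case: ifP => _; [exists a|exists b].
- by exists a.
Qed.

Let nth_pad s N : (size s <= N)%N ->
  [seq nth e s i | i <- iota 0 N] = s ++ nseq (N - size s) e.
Proof.
move=> sN; apply: (@eq_from_nth _ e).
  by rewrite size_map size_iota size_cat size_nseq subnKC.
move=> i; rewrite size_map size_iota => iN.
rewrite (nth_map 0%N) ?size_iota// nth_iota// add0n nth_cat.
by case: ltnP => // si; rewrite nth_nseq if_same nth_default.
Qed.

Let matching_of_perm s t N (sigma : 'S_N) :
  (size s <= N)%N -> (size t <= N)%N ->
  exists2 p, matching p s t & cost p = match_cost s t sigma.
Proof.
move=> sN tN.
exists [seq (nth e s i, nth e t (sigma i)) | i : 'I_N <- enum 'I_N]; last first.
  by rewrite big_map big_enum.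
split.
  rewrite /unzip1 -map_comp.
  rewrite (_ : map _ _ = s ++ nseq (N - size s) e); first exact: sp_equiv_nseq.
  by rewrite -nth_pad// -val_enum_ord -map_comp.
apply: (sp_equiv_trans _ (sp_equiv_nseq (N - size t) t)); apply: perm_sp_equiv.
rewrite -nth_pad// -val_enum_ord /unzip2 -!map_comp.
rewrite [X in perm_eq X](map_comp (nth e t \o val) sigma).
apply: perm_map; rewrite -enumT.
apply: uniq_perm; rewrite ?(map_inj_uniq perm_inj) ?enum_uniq//.
move=> i; rewrite mem_enum inE; apply/mapP; exists (sigma^-1%g i).
  by rewrite mem_enum.
by rewrite permKV.
Qed.

Let perm_map_lift (T1 T2 : eqType) (f : T1 -> T2) (p : seq T1) (v : seq T2) :
  perm_eq (map f p) v -> exists2 q, perm_eq q p & map f q = v.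
Proof.
elim: v p => [|y v IH] p.
  by case: p => [|x p /perm_size//]; exists [::].
move=> pv; have : y \in map f p by rewrite (perm_mem pv) mem_head.
move=> /mapP[x xp yx]; have pE := perm_to_rem xp.
have : perm_eq (map f (rem x p)) v.
  rewrite -(perm_cons y) (perm_trans _ pv)// perm_sym yx.
  by rewrite (perm_map f pE).
move=> /IH[q qp qv]; exists (x :: q); last by rewrite /= qv yx.
by rewrite perm_sym (perm_trans pE)// perm_cons perm_sym.
Qed.

Let sp_equiv_pad s t N : sp_equiv s t -> size s = N -> (size t <= N)%N ->
  perm_eq s (t ++ nseq (N - size t) e).
Proof.
move=> /asboolP[a [b st]] sN tN.
have /eqP sz : size (s ++ nseq a e) = size (t ++ nseq b e) by exact: perm_size.
have ba : b = (N - size t + a)%N.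
  by move: sz; rewrite !size_cat !size_nseq sN => /eqP sz; lia.
by move: st; rewrite ba nseqD catA perm_cat2r.
Qed.

Let cost_pad n (p : seq (X * X)) : cost (p ++ nseq n (e, e)) = cost p.
Proof.
rewrite big_cat/= [X in _ + X]big1_seq ?addr0// => i /=.
by rewrite mem_nseq => /andP[_ /eqP ->]; rewrite mdistxx.
Qed.

Let perm_of_matching s t p : matching p s t ->
  exists N (sigma : 'S_N), (size s + size t <= N)%N /\
    match_cost s t sigma = cost p.
Proof.
move=> [ps pt]; pose N := (size p + size s + size t)%N.
pose q := p ++ nseq (N - size p) (e, e).
have q1 : unzip1 q = unzip1 p ++ nseq (N - size p) e.
  by rewrite /unzip1 map_cat map_nseq.
have q2 : unzip2 q = unzip2 p ++ nseq (N - size p) e.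
  by rewrite /unzip2 map_cat map_nseq.
have sq : size q = N by rewrite size_cat size_nseq subnKC// /N; lia.
have qs : perm_eq (unzip1 q) (s ++ nseq (N - size s) e).
  apply: sp_equiv_pad; [|by rewrite size_map|by rewrite /N; lia].
  by rewrite q1; exact: sp_equiv_trans (sp_equiv_nseq _ _) ps.
have qt : perm_eq (unzip2 q) (t ++ nseq (N - size t) e).
  apply: sp_equiv_pad; [|by rewrite size_map|by rewrite /N; lia].
  by rewrite q2; exact: sp_equiv_trans (sp_equiv_nseq _ _) pt.
have [r rq rs] := perm_map_lift qs.
have rt : perm_eq (unzip2 r) (t ++ nseq (N - size t) e).
  exact: perm_trans (perm_map _ rq) qt.
have sr : size r = N by rewrite (perm_size rq).
have sr2 : size (unzip2 r) == N by rewrite size_map sr.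
have st2 : size (t ++ nseq (N - size t) e) == N.
  by rewrite size_cat size_nseq subnKC// /N; lia.
have /tuple_permP[sigma rE] : perm_eq (Tuple sr2) (Tuple st2) by [].
exists N, sigma; split; first by rewrite /N; lia.
rewrite -(cost_pad (N - size p)) -/q -(perm_big _ rq) /=.
rewrite (big_nth (e, e)) big_mkord sr; apply: eq_bigr => i _.
have ir : (i < size r)%N by rewrite sr.
have pad v j : nth e (v ++ nseq (N - size v) e) j = nth e v j.
  rewrite nth_cat; case: ltnP => // vj.
  by rewrite nth_nseq if_same nth_default.
rewrite -(pad s) -(pad t) -rs -(nth_map _ e fst)// -(nth_map _ e snd)//.
congr mdist; have := congr1 (fun v => nth e v i) rE; rewrite /= => ->.
rewrite (nth_map i) ?size_enum_ord// nth_ord_enum.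
by rewrite (tnth_nth e).
Qed.

Let has_inf_match s t : has_inf
  [set min_match_cost s t N | N in [set N | (size s + size t <= N)%N]].
Proof.
split.
  by exists (min_match_cost s t (size s + size t)), (size s + size t)%N => /=.
exists 0 => _ [N _ <-]; have [[sigma ->] _] := min_match_costP s t N.
exact: match_cost_ge0.
Qed.

Let match_dist_le s t p : matching p s t -> match_dist s t <= cost p.
Proof.
move=> /perm_of_matching[N [sigma [stN <-]]].
apply: le_trans ((min_match_costP s t N).2 sigma).
by apply: ge_inf; [case: (has_inf_match s t)|exists N].
Qed.

Let match_dist_lt s t (eps : R) : 0 < eps ->
  exists2 p, matching p s t & cost p < match_dist s t + eps.
Proof.
move=> eps0; have [_ [N /= stN <-]] := inf_adherent eps0 (has_inf_match s t).
have [[sigma ->] _] := min_match_costP s t N.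
have [||p pst <-] := @matching_of_perm s t N sigma; [lia|lia|].
by exists p.
Qed.

Let match_dist_homo s t s' t' :
  (forall p, matching p s t ->
    exists2 q, matching q s' t' & cost q <= cost p) ->
  match_dist s' t' <= match_dist s t.
Proof.
move=> H; apply/ler_addgt0Pr => eps eps0.
have [p pst plt] := match_dist_lt s t eps0.
have [q qst qp] := H _ pst.
exact: le_trans (match_dist_le qst) (le_trans qp (ltW plt)).
Qed.

Let match_dist_equiv s t s' t' : sp_equiv s s' -> sp_equiv t t' ->
  match_dist s t = match_dist s' t'.
Proof.
move=> ss' tt'; apply/eqP; rewrite eq_le; apply/andP; split.
  apply: match_dist_homo => p [ps pt]; exists p => //; split.
    by apply: sp_equiv_trans ps _; rewrite sp_equiv_sym.
  by apply: sp_equiv_trans pt _; rewrite sp_equiv_sym.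
apply: match_dist_homo => p [ps pt]; exists p => //; split.
  exact: sp_equiv_trans ps _.
exact: sp_equiv_trans pt _.
Qed.

Lemma sp_dist_class s t : sp_dist (sp_class s) (sp_class t) = match_dist s t.
Proof. by apply: match_dist_equiv; exact: sp_repr_class. Qed.

Let match_dist_ge0 s t : 0 <= match_dist s t.
Proof.
apply: lb_le_inf; first by case: (has_inf_match s t).
move=> _ [N _ <-]; have [[sigma ->] _] := min_match_costP s t N.
exact: match_cost_ge0.
Qed.

Lemma sp_distxx (a : SP) : sp_dist a a = 0.
Proof.
apply/eqP; rewrite eq_le match_dist_ge0 andbT.
pose p := [seq (x, x) | x <- repr a].
have -> : 0 = cost p.
  by rewrite big_map big1// => x _ /=; rewrite mdistxx.
apply: match_dist_le; rewrite /unzip1 /unzip2 -!map_comp /comp /=.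
by rewrite map_id; split; exact: sp_equiv_refl.
Qed.

Lemma sp_dist_sym (a b : SP) : sp_dist a b = sp_dist b a.
Proof.
suff H (s t : seq X) : match_dist s t <= match_dist t s.
  by apply/eqP; rewrite eq_le !H.
apply: match_dist_homo => p [pt ps].
exists [seq (xy.2, xy.1) | xy <- p].
  by rewrite /unzip1 /unzip2 -!map_comp.
by rewrite big_map le_eqVlt (eq_bigr _ (fun i _ => metric_sym _ _)) eqxx.
Qed.

Let matching_trans s t u p q : matching p s t -> matching q t u ->
  exists2 r, matching r s u & cost r <= cost p + cost q.
Proof.
move=> [ps pt] [qt qu].
have : sp_equiv (unzip2 p) (unzip1 q).
  by apply: sp_equiv_trans pt _; rewrite sp_equiv_sym.
move=> /asboolP[a [b pq]].
pose p' := p ++ nseq a (e, e); pose q0 := q ++ nseq b (e, e).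
have p1 : unzip1 p' = unzip1 p ++ nseq a e by rewrite /unzip1 map_cat map_nseq.
have p2 : unzip2 p' = unzip2 p ++ nseq a e by rewrite /unzip2 map_cat map_nseq.
have q1 : unzip1 q0 = unzip1 q ++ nseq b e by rewrite /unzip1 map_cat map_nseq.
have q2 : unzip2 q0 = unzip2 q ++ nseq b e by rewrite /unzip2 map_cat map_nseq.
have : perm_eq (unzip1 q0) (unzip2 p') by rewrite q1 p2 perm_sym.
move=> /perm_map_lift[q' q'q q'p].
rewrite -/(unzip1 q') in q'p.
have szq : size q' = size p'.
  by move: (congr1 size q'p); rewrite !size_map.
exists (zip (unzip1 p') (unzip2 q')).
  rewrite unzip1_zip ?unzip2_zip ?size_map ?szq//; split.
    by rewrite p1; exact: sp_equiv_trans (sp_equiv_nseq _ _) ps.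
  apply: (@sp_equiv_trans (unzip2 q0)).
    by apply: perm_sp_equiv; exact: perm_map.
  by rewrite q2; exact: sp_equiv_trans (sp_equiv_nseq _ _) qu.
rewrite -(cost_pad a p) -(cost_pad b q) -/p' -/q0 -(perm_big _ q'q) /=.
elim: p' q' q'p szq {p1 p2 q1 q2 q'q} => [|[x y] p' IH] [|[y' z] q']//=.
  by rewrite !big_nil addr0.
move=> [-> qp] [szq]; rewrite !big_cons /=.
rewrite addrACA lerD ?IH//.
exact: metric_triangle.
Qed.

Lemma sp_dist_triangle (b a c : SP) : sp_dist a c <= sp_dist a b + sp_dist b c.
Proof.
apply/ler_addgt0Pr => eps eps0; have eps20 : 0 < eps / 2 by rewrite divr_gt0.
have [p pab plt] := match_dist_lt (repr a) (repr b) eps20.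
have [q qbc qlt] := match_dist_lt (repr b) (repr c) eps20.
have [r rac rle] := matching_trans pab qbc.
apply: le_trans (match_dist_le rac) (le_trans rle _).
rewrite [eps]splitr addrACA.
exact: ltW (ltrD plt qlt).
Qed.

Let min_sep (s t : seq X) : exists2 delta : R, 0 < delta &
  forall x y, x \in s -> y \in t -> mdist x y < delta -> x = y.
Proof.
pose ds := [seq mdist xy.1 xy.2 |
  xy <- [seq (x, y) | x <- s, y <- t] & xy.1 != xy.2].
exists (\big[Num.min/1]_(d <- ds) d).
  rewrite big_seq; elim/big_ind: _ => // [x y x0 y0|d].
    by rewrite lt_min x0.
  move=> /mapP[[x y]]; rewrite mem_filter/= => /andP[xy _] ->.
  by rewrite mdist_gt0.
move=> x y xs yt; apply: contraPP => /eqP xy; apply/negP; rewrite -leNgt.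
have : mdist x y \in ds.
  apply/mapP; exists (x, y) => //; rewrite mem_filter /= xy.
  by apply/allpairsP; exists (x, y).
elim: ds => // d ds IH; rewrite inE big_cons ge_min => /orP[/eqP ->|/IH ->].
  by rewrite lexx.
by rewrite orbT.
Qed.

Lemma sp_dist_positivity (a b : SP) : sp_dist a b = 0 -> a = b.
Proof.
move=> ab0; set s := repr a; set t := repr b.
have [delta delta0 dP] := min_sep (e :: s) (e :: t).
have [p [ps pt]] := match_dist_lt s t delta0.
rewrite -/(sp_dist a b) ab0 add0r => plt.
have mem_equiv v w x : sp_equiv v w -> x \in v -> x \in e :: w.
  rewrite sp_equivE inE => /perm_mem/(_ x); rewrite !mem_filter /=.
  by case: eqVneq => //= _ ->.
rewrite -[a]sp_reprK -[b]sp_reprK; apply/sp_classP.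
suff pE : unzip1 p = unzip2 p.
  by apply: sp_equiv_trans pt; rewrite -pE sp_equiv_sym.
apply/eq_in_map => -[x y] xyp /=.
apply: dP.
- by apply: mem_equiv ps _; apply/mapP; exists (x, y).
- by apply: mem_equiv pt _; apply/mapP; exists (x, y).
apply: le_lt_trans plt; rewrite (perm_big _ (perm_to_rem xyp)) big_cons /=.
by rewrite lerDl.
Qed.

HB.instance Definition _ :=
  isMetric.Build R SP sp_distxx sp_dist_positivity sp_dist_sym sp_dist_triangle.

Lemma sp_mdist_class s t : mdist (sp_class s) (sp_class t) = match_dist s t.
Proof. exact: sp_dist_class. Qed.

Let matching_cancel z s t p : matching p (z :: s) (z :: t) ->
  exists2 q, matching q s t & cost q <= cost p.
Proof.
have [->|ze] := eqVneq z e.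
  move=> [ps pt]; exists p => //; split.
    exact: sp_equiv_trans ps (sp_equiv_e _).
  exact: sp_equiv_trans pt (sp_equiv_e _).
have mem v w : sp_equiv v (z :: w) -> z \in v.
  rewrite sp_equivE => /perm_mem/(_ z).
  by rewrite !mem_filter /= inE eqxx ze.
move=> [ps pt].
have /mapP[[z' y] zyp /= zz'] := mem _ _ ps; subst z'.
have pE := perm_to_rem zyp; set p1 := rem _ _ in pE.
have costE : cost p = mdist z y + cost p1 by rewrite (perm_big _ pE) big_cons.
have p1s : sp_equiv (unzip1 p1) s.
  rewrite -(sp_equiv_cons z); apply: sp_equiv_trans ps; apply: perm_sp_equiv.
  by rewrite perm_sym; exact: (perm_map fst pE).
have p1t : sp_equiv (y :: unzip2 p1) (z :: t).
  apply: sp_equiv_trans pt; apply: perm_sp_equiv.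
  by rewrite perm_sym; exact: (perm_map snd pE).
have [zy|yz] := eqVneq z y.
  exists p1; last by rewrite costE lerDr mdist_ge0.
  by split => //; rewrite -(sp_equiv_cons z) {1}zy.
have := mem _ _ p1t; rewrite inE (negbTE yz) /= => /mapP[[x z'] xzp /= zz'].
subst z'; have p1E := perm_to_rem xzp; set p2 := rem _ _ in p1E.
exists ((x, y) :: p2); last first.
  rewrite costE (perm_big _ p1E) !big_cons /= addrA lerD2r addrC.
  exact: metric_triangle.
split => /=.
  apply: sp_equiv_trans p1s; apply: perm_sp_equiv.
  by rewrite perm_sym; exact: (perm_map fst p1E).
rewrite -(sp_equiv_cons z); apply: sp_equiv_trans p1t; apply: perm_sp_equiv.
rewrite (perm_catCA [:: z] [:: y]) /= perm_cons perm_sym.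
exact: (perm_map snd p1E).
Qed.

Lemma sp_mdistDr (a b c : SP) : mdist (a + c) (b + c) = mdist a b.
Proof.
apply/eqP; rewrite -[a]sp_reprK -[b]sp_reprK -[c]sp_reprK.
set s := repr a; set t := repr b; set u := repr c.
rewrite ![_ + sp_class u]addrC -!sp_class_cat !sp_mdist_class.
elim: u => //= z u /eqP <-; rewrite eq_le; apply/andP; split; last first.
  by apply: match_dist_homo => p; exact: matching_cancel.
apply: match_dist_homo => p [ps pt]; exists ((z, z) :: p).
  by rewrite /= !sp_equiv_cons.
by rewrite big_cons /= mdistxx add0r.
Qed.

End infinite_symmetric_product.

Section free_abelian_group.
Context {R : realType} {X : metricType R} (e : X).

Local Notation "<< k *g x >>" := (Freeg [:: (k, x)]).

(* The subgroup generated by e; the quotient by it identifies e with 0. *)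
Definition basepoint_multiples : {pred {freeg X / int}} :=
  fun D => `[< exists k : int, D = << k *g e >> >].

Lemma basepoint_multiples_zmod_closed : zmod_closed basepoint_multiples.
Proof.
split=> [|D1 D2 /asboolP[k1 ->] /asboolP[k2 ->]]; apply/asboolP.
  by exists 0; apply/eqP/freeg_eqP => x; rewrite coeff0 coeffU mul0r.
exists (k1 - k2); apply/eqP/freeg_eqP => x.
by rewrite coeffB !coeffU mulrBl.
Qed.

HB.instance Definition _ := GRing.isZmodClosed.Build {freeg X / int}
  basepoint_multiples basepoint_multiples_zmod_closed.

Definition ZX := Quotient.quot basepoint_multiples.

HB.instance Definition _ := GRing.Zmodule.on ZX.

Definition ZX_class (D : {freeg X / int}) : ZX :=
  \pi_(Quotient.quot basepoint_multiples) D.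

Let ZX_class_eq D1 D2 :
  ZX_class D1 = ZX_class D2 <-> exists k : int, D1 - D2 = << k *g e >>.
Proof.
rewrite /ZX_class; split.
  by move=> /eqP; rewrite -Quotient.idealrBE => /asboolP.
by move=> D12; apply/eqP; rewrite -Quotient.idealrBE; apply/asboolP.
Qed.

Let ZX_classD D1 D2 : ZX_class (D1 + D2) = ZX_class D1 + ZX_class D2.
Proof. exact: Quotient.pi_add. Qed.

Let ZX_class0 : ZX_class 0 = 0.
Proof. by apply: (addrI (ZX_class 0)); rewrite -ZX_classD !addr0. Qed.

Let ZX_classN D : ZX_class (- D) = - ZX_class D.
Proof. exact: Quotient.pi_opp. Qed.

Let ZX_class_sum (s : seq X) :
  ZX_class (\sum_(x <- s) << 1 *g x >>) = \sum_(x <- s) ZX_class << 1 *g x >>.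
Proof. exact: (big_morph _ ZX_classD ZX_class0). Qed.

Definition SP_to_ZX (a : SP e) : ZX :=
  \sum_(x <- repr a) ZX_class << 1 *g x >>.

Let coeff_sumU (y : X) (s : seq X) :
  coeff y (\sum_(x <- s) << (1 : int) *g x >>) = (count_mem y s)%:R.
Proof.
elim: s => [|x s IH]; first by rewrite big_nil coeff0.
by rewrite big_cons coeffD IH coeffU mul1r /= natrD.
Qed.

Let sum_ZX_eq (s t : seq X) :
  (\sum_(x <- s) ZX_class << 1 *g x >> = \sum_(x <- t) ZX_class << 1 *g x >>)
  <-> sp_equiv e s t.
Proof.
rewrite -!ZX_class_sum ZX_class_eq sp_equivE; split=> [[k kE]|st].
  apply/allP => /= y _; rewrite !count_filter; apply/eqP.
  have [->|ye] := eqVneq y e.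
    by rewrite !(@eq_count _ _ pred0) ?count_pred0// => x /=;
      case: (x =P e).
  rewrite !(@eq_count _ _ (pred1 y)); first last.
  - by move=> x /=; case: (x =P y) => // ->.
  - by move=> x /=; case: (x =P y) => // ->.
  apply/eqP; rewrite -(eqr_nat int) -!coeff_sumU -subr_eq0 -coeffB kE coeffU.
  by rewrite (eq_sym e) (negbTE ye) mulr0.
exists ((count_mem e s)%:R - (count_mem e t)%:R).
apply/eqP/freeg_eqP => y; rewrite coeffB !coeff_sumU coeffU.
have [<-|ey] := eqVneq e y; first by rewrite mulr1.
rewrite mulr0; apply/eqP; rewrite subr_eq0 eqr_nat; apply/eqP.
move: st => /seq.permP/(_ (pred1 y)); rewrite !count_filter.
by rewrite !(@eq_count _ (predI (pred1 y) _) (pred1 y))// => x /=;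
  case: (x =P y) => // ->; rewrite eq_sym ey.
Qed.

Lemma SP_to_ZX_class (s : seq X) :
  SP_to_ZX (sp_class e s) = \sum_(x <- s) ZX_class << 1 *g x >>.
Proof. by apply/sum_ZX_eq; exact: sp_repr_class. Qed.

Lemma SP_to_ZX_inj : injective SP_to_ZX.
Proof.
move=> a b; rewrite -[a]sp_reprK -[b]sp_reprK !SP_to_ZX_class.
by move=> /sum_ZX_eq/sp_classP.
Qed.

Lemma SP_to_ZXD : {morph SP_to_ZX : a b / a + b}.
Proof.
move=> a b; rewrite -[a]sp_reprK -[b]sp_reprK -sp_class_cat !SP_to_ZX_class.
by rewrite big_cat.
Qed.

Lemma SP_to_ZX0 : SP_to_ZX 0 = 0.
Proof. by apply: (addrI (SP_to_ZX 0)); rewrite -SP_to_ZXD !addr0. Qed.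

Lemma ZX_decomposition (x : ZX) :
  exists p : SP e * SP e, x = SP_to_ZX p.1 - SP_to_ZX p.2.
Proof.
have natU n y : exists a, ZX_class << n%:Z *g y >> = SP_to_ZX a.
  exists (sp_class e (nseq n y)); rewrite SP_to_ZX_class -ZX_class_sum.
  congr ZX_class; apply/eqP/freeg_eqP => z; rewrite coeff_sumU coeffU.
  by rewrite count_nseq /= natrM mulrC !natz.
have intU k y : exists p : SP e * SP e,
    ZX_class << k *g y >> = SP_to_ZX p.1 - SP_to_ZX p.2.
  case: k => n.
    by have [a ->] := natU n y; exists (a, 0); rewrite SP_to_ZX0 subr0.
  have [a aE] := natU n.+1 y; exists (0, a).
  rewrite SP_to_ZX0 sub0r -aE -ZX_classN; congr ZX_class.
  by apply/eqP/freeg_eqP => z; rewrite coeffN !coeffU NegzE mulNr.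
have -> : x = ZX_class (repr x) by rewrite /ZX_class reprK.
elim/freeg_ind_dom0: (repr x) => [|k y D _ _ [p DE]].
  by exists (0, 0); rewrite /= subrr ZX_class0.
have [q qE] := intU k y; exists (q.1 + p.1, q.2 + p.2).
by rewrite ZX_classD DE qE !SP_to_ZXD opprD addrACA.
Qed.

Definition ZX_decomp (x : ZX) : SP e * SP e :=
  projT1 (cid (ZX_decomposition x)).

Local Notation "x '^pos'" := (ZX_decomp x).1 (at level 2, format "x '^pos'").
Local Notation "x '^neg'" := (ZX_decomp x).2 (at level 2, format "x '^neg'").

Definition ZX_dist (x y : ZX) : R := mdist (x^pos + y^neg) (y^pos + x^neg).

Lemma ZX_decompE (x : ZX) : x = SP_to_ZX x^pos - SP_to_ZX x^neg.
Proof. by rewrite /ZX_decomp; case: cid. Qed.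

Let ZX_eq (a b c d : SP e) :
  SP_to_ZX a - SP_to_ZX b = SP_to_ZX c - SP_to_ZX d -> a + d = c + b.
Proof.
move=> /(congr1 (fun z => z + (SP_to_ZX b + SP_to_ZX d))).
rewrite addrA subrK addrCA subrK [RHS]addrC -!SP_to_ZXD.
exact: SP_to_ZX_inj.
Qed.

(* The value does not depend on the chosen decompositions. *)
Lemma ZX_distE (a b c d : SP e) :
  ZX_dist (SP_to_ZX a - SP_to_ZX b) (SP_to_ZX c - SP_to_ZX d) =
  mdist (a + d) (c + b).
Proof.
set x := SP_to_ZX a - _; set y := SP_to_ZX c - _.
have xE := ZX_eq (esym (ZX_decompE x)); have yE := ZX_eq (esym (ZX_decompE y)).
rewrite /ZX_dist -(sp_mdistDr _ _ (b + d)).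
rewrite -(sp_mdistDr (a + d) _ (x^neg + y^neg)).
rewrite (addrACA x^pos) xE [in LHS](addrC b d) (addrACA y^pos) yE.
rewrite [in RHS](addrACA a) [in RHS](addrC x^neg) [in RHS](addrACA c).
by rewrite (addrC d) (addrC b).
Qed.

Lemma ZX_distxx (x : ZX) : ZX_dist x x = 0.
Proof. exact: mdistxx. Qed.

Lemma ZX_dist_positivity (x y : ZX) : ZX_dist x y = 0 -> x = y.
Proof.
move=> /mdist_positivity xy; rewrite (ZX_decompE x) (ZX_decompE y).
apply/eqP; rewrite subr_eq addrAC eq_sym subr_eq; apply/eqP.
by rewrite -!SP_to_ZXD xy.
Qed.

Lemma ZX_dist_sym (x y : ZX) : ZX_dist x y = ZX_dist y x.
Proof. exact: metric_sym. Qed.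

Lemma ZX_dist_triangle (y x z : ZX) :
  ZX_dist x z <= ZX_dist x y + ZX_dist y z.
Proof.
rewrite /ZX_dist -(sp_mdistDr (x^pos + z^neg) _ y^neg).
rewrite -(sp_mdistDr (x^pos + y^neg) _ z^neg).
rewrite -(sp_mdistDr (y^pos + z^neg) _ x^neg).
rewrite (addrAC x^pos) (addrAC y^pos) (addrAC z^pos).
exact: metric_triangle.
Qed.

HB.instance Definition _ :=
  isMetric.Build R ZX ZX_distxx ZX_dist_positivity ZX_dist_sym ZX_dist_triangle.

End free_abelian_group.

(* Main.v *)
Require Import Defs.
From mathcomp Require Import all_boot all_order all_algebra.
From mathcomp Require Import all_classical all_reals all_analysis.

Import GRing.Theory.

Local Open Scope classical_set_scope.
Local Open Scope ring_scope.

(** The matching distance on ZX is translation invariant ([ZX_mdistDr]): adding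
    c - d to both arguments adds the same element c + d of SP to both arguments
    of the matching distance on SP, which is itself translation invariant
    because, by the triangle inequality, an optimal matching may be assumed to
    pair a point common to two lists with itself.

    An abelian group with a translation-invariant metric is always a
    topological group. By the triangle inequality through x' + y, addition is
    1-Lipschitz for the sum of the distances of the coordinates
    ([ZX_mdistDD_le]), and translating by x + y shows that negation is an
    isometry ([ZX_mdistNN]). *)

(** In ZX_distE the negative parts cross over, so that c and d both land on
    each side, where they cancel by the invariance of the distance on SP. *)
Lemma ZX_mdistDr {R : realType} {X : metricType R} (e : X) (x y z : ZX e) :
  mdist (x + z) (y + z) = mdist x y.
Proof.
rewrite (ZX_decompE x) (ZX_decompE y) (ZX_decompE z).
set a := (ZX_decomp x).1; set b := (ZX_decomp x).2.
set a' := (ZX_decomp y).1; set b' := (ZX_decomp y).2.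
set c := (ZX_decomp z).1; set d := (ZX_decomp z).2.
rewrite !(addrACA _ (- _)) -!opprD -!SP_to_ZXD.
rewrite [LHS]ZX_distE [RHS]ZX_distE.
by rewrite (addrACA a) (addrACA a') sp_mdistDr.
Qed.

Lemma ZX_mdistDD_le {R : realType} {X : metricType R} (e : X)
    (x x' y y' : ZX e) :
  mdist (x + y) (x' + y') <= mdist x x' + mdist y y'.
Proof.
rewrite -(ZX_mdistDr _ x x' y) -(ZX_mdistDr _ y y' x').
by rewrite (addrC y) (addrC y'); exact: metric_triangle.
Qed.

Lemma ZX_mdistNN {R : realType} {X : metricType R} (e : X) (x y : ZX e) :
  mdist (- x) (- y) = mdist x y.
Proof.
by rewrite -(ZX_mdistDr _ (- x) (- y) (x + y)) addKr (addrC x) addKr metric_sym.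
Qed.

Theorem theorem5p3 (R : realType) (X : metricType R) (e : X) :
  continuous (fun x : ZX e * ZX e => x.1 + x.2) /\
  continuous (-%R : ZX e -> ZX e).
Proof.
split=> [[x y]|x];
  apply: (metricType_numDomainType.cvgrPdist_lt (FF := nbhs_filter _) _ _).2
    => eps eps0.
  have eps20 : 0 < eps / 2 by rewrite Num.Theory.divr_gt0.
  exists (ball x (eps / 2), ball y (eps / 2)).
    by split; exact: nbhsx_ballx.
  move=> [x' y'] /=; rewrite !ballEmdist => -[/= xx' yy'].
  apply: Order.POrderTheory.le_lt_trans (ZX_mdistDD_le _ _ _ _ _) _.
  by rewrite [eps]Num.Theory.splitr Num.Theory.ltrD.
apply: filterS (nbhsx_ballx x eps eps0) => x'.
by rewrite ballEmdist /= ZX_mdistNN.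
Qed.
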